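(* Let $l^{(2)}(t)$ and $u^{(2)}(t)$ be functions such that $0<l^{(2)}(t)\le m^{(2)}_{\lambda}(t)\le u^{(2)}(t)$ for all $\lambda\ge 1$ and any $t$. Let $\xi^{*}(t)=\max\left\{\frac{1}{u^{(2)}(t)},\min\left\{\frac{1}{m_{0,2}},\frac{1}{l^{(2)}(t)}\right\}\right\}$. If $P_{\boldsymbol\theta}[l^{(2)}(D)\le m_{0,2}\le u^{(2)}(D)]<1$ for all $\boldsymbol\theta\in\Theta_0$, then, under the GPN criterion with a general loss function, the estimator $\delta_{\xi^{*}}(\mathbf{X})=\xi^{*}(D)X_2$ is nearer to $\theta_2$ than the unrestricted Pitman nearest scale equivariant estimator $\delta_{2,PNSEE}(\mathbf{X})=\frac{X_2}{m_{0,2}}$.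
   Context: $f$ is a specified Lebesgue probability density, and $\mathbf{X}=(X_1,X_2)$ has joint p.d.f. $\frac{1}{\theta_1\theta_2}f\left(\frac{x_1}{\theta_1},\frac{x_2}{\theta_2}\right)$, where $\boldsymbol\theta=(\theta_1,\theta_2)\in\Theta_0=\{(t_1,t_2)\in(0,\infty)^2:t_1\le t_2\}$ is unknown; the support of $\mathbf{X}$ is assumed to be a subset of $(0,\infty)^2$. Put $\lambda=\theta_2/\theta_1\ge1$, $D=X_2/X_1$, $Z_2=X_2/\theta_2$; $m_{0,2}>0$ is the median of $Z_2$. The p.d.f. of $D$ is $f_D(t|\lambda)=\int_0^\infty\frac{\lambda y}{t^2}f\left(\frac{\lambda y}{t},y\right)dy$, and the conditional p.d.f. of $Z_2$ given $D=t$ is $f_\lambda(s|t)=\frac{\lambda s}{t^2}f\left(\frac{\lambda s}{t},s\right)/f_D(t|\lambda)$ ($t$ in the support of $D$). $m^{(2)}_\lambda(t)$ denotes the median of this conditional distribution, so $\int_0^{m^{(2)}_\lambda(t)}sf(\frac{\lambda s}{t},s)\,ds=\frac12\int_0^\infty sf(\frac{\lambda s}{t},s)\,ds$. General loss function: $L_2(\boldsymbol\theta,a)=W(a/\theta_2)$, $a\in(0,\infty)$, where $W:(0,\infty)\to[0,\infty)$ satisfies $W(1)=0$, $W$ strictly decreasing on $(0,1)$ and strictly increasing on $(1,\infty)$. GPN criterion: for estimators $\delta_1,\delta_2$ of $\theta_2$, $GPN(\delta_1,\delta_2;\boldsymbol\theta)=P_{\boldsymbol\theta}[L_2(\boldsymbol\theta,\delta_1)<L_2(\boldsymbol\theta,\delta_2)]+\frac12P_{\boldsymbol\theta}[L_2(\boldsymbol\theta,\delta_1)=L_2(\boldsymbol\theta,\delta_2)]$.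 $\delta_1$ is nearer to $\theta_2$ than $\delta_2$ if $GPN(\delta_1,\delta_2;\boldsymbol\theta)\ge\frac12$ for all $\boldsymbol\theta\in\Theta_0$, with strict inequality for some $\boldsymbol\theta\in\Theta_0$. All functions defining estimators are understood to be Borel measurable.
   Formalization: The loss W is additionally assumed continuous at 1; without this the strict inequality can fail (e.g. W(x)=1-x on (0,1], W(x)=1+x on (1,∞), with l(t) equal to the conditional median, gives GPN = 1/2 for every θ). *)

(* Defs.v *)
From mathcomp Require Export all_boot all_order all_algebra.
From mathcomp Require Export all_classical all_reals all_analysis.
Export Order.TTheory GRing.Theory Num.Theory.
Export numFieldNormedType.Exports.

Set Implicit Arguments.
Unset Strict Implicit.
Unset Printing Implicit Defensive.

Local Open Scope classical_set_scope.
Local Open Scope ring_scope.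

Section Definitions.
Context {R : realType}.

Local Notation mu := (@lebesgue_measure R).

Definition is_pdf2 (f : R * R -> R) : Prop :=
  [/\ measurable_fun setT f, forall x, 0 <= f x &
      (\int[(mu \x mu)%E]_x (f x)%:E = 1)%E].

Definition Theta0 : set (R * R) :=
  [set theta | 0 < theta.1 /\ theta.1 <= theta.2].

Definition joint_pdf (f : R * R -> R) (theta x : R * R) : R :=
  (theta.1 * theta.2)^-1 * f (x.1 / theta.1, x.2 / theta.2).

Definition scale_model (f : R * R -> R) (d : measure_display)
    (Omega : measurableType d) (P : R * R -> probability Omega R)
    (X : Omega -> R * R) : Prop :=
  forall theta, Theta0 theta ->
    (forall A : set (R * R), measurable A ->
      (P theta (X @^-1` A) =
        \int[mu \x mu]_(x in A) (joint_pdf f theta x)%:E)%E) /\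
    P theta [set w | 0 < (X w).1 /\ 0 < (X w).2] = 1%E.

Definition is_median (nu : set R -> \bar R) (m : R) : Prop :=
  ((2^-1)%:E <= nu `]-oo, m]%classic)%E /\ ((2^-1)%:E <= nu `[m, +oo[%classic)%E.

Definition pdf_D (f : R * R -> R) (lam t : R) : \bar R :=
  (\int[mu]_(y in `]0%R, +oo[) (lam * y / t ^+ 2 * f (lam * y / t, y))%:E)%E.

(* The values t at which the conditional law of Z2 given D = t is given by
   its density formula; [pdf_D f lam] may be infinite on a null set. *)
Definition supp_D (f : R * R -> R) (lam : R) : set R :=
  [set t | 0 < t /\ (0 < pdf_D f lam t < +oo)%E].

Definition cond_pdf_Z2 (f : R * R -> R) (lam t s : R) : R :=
  lam * s / t ^+ 2 * f (lam * s / t, s) / fine (pdf_D f lam t).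

Definition cond_law_Z2 (f : R * R -> R) (lam t : R) (A : set R) : \bar R :=
  (\int[mu]_(s in (A `&` `]0%R, +oo[)%classic) (cond_pdf_Z2 f lam t s)%:E)%E.

(* W is only meaningful on ]0, +oo[. *)
Definition general_loss (W : R -> R) : Prop :=
  [/\ W 1 = 0,
      forall x, 0 < x -> 0 <= W x,
      forall x y, 0 < x -> x < y -> y < 1 -> W y < W x &
      forall x y, 1 < x -> x < y -> W x < W y].

(* The values of W outside ]0, +oo[ are discarded (replaced by 0), so that the
   events below are measurable whatever these values are. *)
Definition L2 (W : R -> R) (theta : R * R) (a : R) : R :=
  (W \_ `]0, +oo[%classic) (a / theta.2).

Definition GPN (W : R -> R) (d : measure_display) (Omega : measurableType d)
    (P : R * R -> probability Omega R) (X : Omega -> R * R)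
    (delta1 delta2 : R * R -> R) (theta : R * R) : \bar R :=
  (P theta [set w | (L2 W theta (delta1 (X w)) < L2 W theta (delta2 (X w)))%R]
   + (2^-1)%:E *
   P theta [set w | L2 W theta (delta1 (X w)) = L2 W theta (delta2 (X w))])%E.

Definition nearer (W : R -> R) (d : measure_display) (Omega : measurableType d)
    (P : R * R -> probability Omega R) (X : Omega -> R * R)
    (delta1 delta2 : R * R -> R) : Prop :=
  (forall theta, Theta0 theta ->
    ((2^-1)%:E <= GPN W P X delta1 delta2 theta)%E) /\
  (exists2 theta, Theta0 theta &
    ((2^-1)%:E < GPN W P X delta1 delta2 theta)%E).

Definition Dstat (x : R * R) : R := x.2 / x.1.

Definition delta_scale (xi : R -> R) (x : R * R) : R := xi (Dstat x) * x.2.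

Definition delta_PNSEE (m0 : R) (x : R * R) : R := x.2 / m0.

Definition xi_star (m0 : R) (l u : R -> R) (t : R) : R :=
  Num.max (u t)^-1 (Num.min m0^-1 (l t)^-1).

End Definitions.

(* Main.v *)
Require Import Defs.
From HB Require Import structures.
From mathcomp Require Import measurable_realfun ring lra.

(* In the coordinates t = x2 / x1, s = x2 / theta2 the law of X has density
   h(t, s) = lam s / t^2 f(lam s / t, s) on the quadrant, so
   P(X in A) = \int_t \int_s 1_A(theta2 s / t, theta2 s) h(t, s), and the two
   estimators can be compared for each fixed t, under the conditional law of Z2
   given D = t. If l(t) <= m0 <= u(t) they coincide. If m0 < l(t), then
   xi_star(t) = 1 / l(t), and by continuity of W at 1 the modified estimator is
   strictly closer for all s > x, for some x < l(t). The conditional mass of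
   ]x, +oo[ exceeds 1/2, since otherwise there would be a conditional median
   below x, whereas l(t) bounds all of them from below. The case u(t) < m0 is
   symmetric. After integration over t the inequality is strict because the
   last two cases together have positive probability. *)

Set Implicit Arguments.
Unset Strict Implicit.
Unset Printing Implicit Defensive.

Local Open Scope classical_set_scope.
Local Open Scope ring_scope.

(** * Change of variables to ratio coordinates *)

Lemma measurable_invr (R : realType) : measurable_fun setT (@GRing.inv R).
Proof.
(* Inversion is continuous except at 0, so the line is cut there and the single point is treated
   apart. *)
have -> : @setT R = `]-oo, 0%R[ `|` ([set 0%R] `|` `]0%R, +oo[).
  apply/esym; rewrite -subTset => x _ /=; rewrite !in_itv/= andbT.
  by case: (ltgtP x 0) => [|| ->]; [left|right; right|right; left].
apply/measurable_funU => //; first exact: measurableU.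
split.
  apply: open_continuous_measurable_fun => [|x]; first exact: interval_open.
  by rewrite inE/= in_itv/= => x0; apply: inv_continuous; rewrite lt_eqF.
apply/measurable_funU => //; split; first exact: measurable_fun_set1.
apply: open_continuous_measurable_fun => [|x]; first exact: interval_open.
by rewrite inE/= in_itv/= andbT => x0; apply: inv_continuous; rewrite gt_eqF.
Qed.

(** * Measures given by a density *)

Section mdensity.
Local Open Scope ereal_scope.
Context d (T : measurableType d) (R : realType).
Variables (mu : {measure set T -> \bar R}) (g : T -> R).
Hypotheses (mg : measurable_fun setT g) (g0 : forall x, (0 <= g x)%R).

(** The two proofs are arguments so that the measure structure can be attached to the term
    [mdensity mg g0]. *)
Definition mdensity of measurable_fun setT g & (forall x, (0 <= g x)%R) :=
  fun A : set T => \int[mu]_(x in A) (g x)%:E.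

Local Notation nu := (mdensity mg g0).

Let nu0 : nu set0 = 0. Proof. exact: integral_set0. Qed.

Let nu_ge0 A : 0 <= nu A.
Proof. by apply: integral_ge0 => x _; rewrite lee_fin. Qed.

Let nu_sigma_additive : semi_sigma_additive nu.
Proof.
move=> /= A mA tA mUA.
rewrite /mdensity ge0_integral_bigcup//; last 2 first.
- by apply/measurable_EFinP; exact: measurable_funTS.
- by move=> x _; rewrite lee_fin.
by apply: is_cvg_ereal_nneg_natsum_cond => n _ _; exact: nu_ge0.
Qed.

HB.instance Definition _ := isMeasure.Build _ _ _ nu nu0 nu_ge0
  nu_sigma_additive.

Import HBNNSimple.

Let integral_mdensity_nnsfun (h : {nnsfun T >-> R}) :
  \int[nu]_x (h x)%:E = \int[mu]_x ((h x)%:E * (g x)%:E).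
Proof.
under [LHS]eq_integral do rewrite fimfunE -fsumEFin//.
rewrite ge0_integral_fsum//; last 2 first.
- by move=> r; exact/measurable_EFinP/measurable_funM.
- by move=> r x _; rewrite nnfun_muleindic_ge0.
under [RHS]eq_integral.
  move=> x _; rewrite fimfunE -fsumEFin// ge0_mule_fsuml; last first.
    by move=> r; rewrite nnfun_muleindic_ge0.
  over.
rewrite [RHS]ge0_integral_fsum//; last 2 first.
- move=> r; apply: emeasurable_funM; last exact/measurable_EFinP.
  exact/measurable_EFinP/measurable_funM.
- move=> r x _; apply: mule_ge0; last by rewrite lee_fin.
  exact: nnfun_muleindic_ge0.
apply: eq_fsbigr => r /set_mem -[y _ <-].
rewrite integralZl_indic_nnsfun// integral_indic// setIT.
under [RHS]eq_integral do rewrite EFinM -muleA.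
rewrite ge0_integralZl_EFin//; last 2 first.
- by move=> x _; rewrite mule_ge0// lee_fin.
- by apply: emeasurable_funM; exact/measurable_EFinP.
congr (_ * _); rewrite /= /mdensity integral_mkcond.
apply: eq_integral => x _; rewrite patchE indicE.
by case: (x \in _); rewrite ?mul1e ?mul0e.
Qed.

(** Linearity gives the formula for simple functions; monotone convergence along simple
    approximations of [h] extends it. *)
Lemma ge0_integral_mdensity (h : T -> \bar R) : measurable_fun setT h ->
  (forall x, 0 <= h x) -> \int[nu]_x h x = \int[mu]_x (h x * (g x)%:E).
Proof.
move=> mh h0.
pose h_ := nnsfun_approx measurableT mh.
have h_h x : EFin \o h_^~ x @ \oo --> h x by exact: cvg_nnsfun_approx.
have nd_h_ x : {homo (fun n => (h_ n x)%:E) : m n / (m <= n)%N >-> m <= n}.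
  by move=> m n mn; rewrite lee_fin; exact/lefP/nd_nnsfun_approx.
transitivity (limn (fun n => \int[nu]_x (h_ n x)%:E)).
  rewrite -monotone_convergence//.
  - by apply: eq_integral => x _; apply/esym/cvg_lim => //; exact: h_h.
  - by move=> n; exact/measurable_EFinP.
  - by move=> n x _; rewrite lee_fin.
transitivity (limn (fun n => \int[mu]_x ((h_ n x)%:E * (g x)%:E))).
  by congr (limn _); apply/funext => n; exact: integral_mdensity_nnsfun.
rewrite -monotone_convergence//.
- apply: eq_integral => x _; apply/cvg_lim => //.
  by apply: cvgeZr => //; exact: h_h.
- by move=> n; apply: emeasurable_funM; exact/measurable_EFinP.
- by move=> n x _; rewrite mule_ge0// lee_fin.
- by move=> x _ m n mn; apply: lee_wpmul2r; [rewrite lee_fin|exact: nd_h_].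
Qed.
End mdensity.

(** * The substitution x = c / t on the positive half-line *)

Section inversion.
Context (R : realType) (c : R).
Hypothesis c0 : 0 < c.
Local Notation mu := (@lebesgue_measure R).

(** The absolute Jacobian of t |-> c / t, cut off to the half-line where the substitution takes
    place. *)
Let w : R -> R := (fun t => c / t ^+ 2) \_ `]0, +oo[.

Let mw : measurable_fun setT w.
Proof.
apply: (measurable_restrictT _ _).1 => //; apply: measurable_funTS.
apply: measurable_funM => //.
by apply: measurableT_comp; [exact: measurable_invr|exact: measurable_funX].
Qed.

Let w0 t : 0 <= w t.
Proof.
rewrite /w patchE; case: ifPn => // /set_mem/=; rewrite in_itv/= andbT => t0.
by rewrite divr_ge0// ?ltW// exprn_gt0.
Qed.

Let phi : R -> measurableTypeR R := fun t => c / t.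

Let mphi : measurable_fun setT phi.
Proof. by apply: measurable_funM => //; exact: measurable_invr. Qed.

(** The substitution formula amounts to this measure being Lebesgue measure on the positive
    half-line. *)
Let nu : {measure set (measurableTypeR R) -> \bar R}.
Proof. by refine (pushforward (mdensity mu mw w0) phi); exact: mphi. Defined.

Let nu_oc (b : R) : 0 < b -> nu `]0, b]%classic = b%:E.
Proof.
move=> b0; rewrite /nu/= /pushforward/= /mdensity.
have -> : phi @^-1` `]0, b] = `[c / b, +oo[%classic.
  apply/seteqP; split => t /=; rewrite !in_itv/= andbT /phi.
    move=> /andP[ct0 ctb].
    have t0 : 0 < t by move: ct0; rewrite pmulr_rgt0// invr_gt0.
    by rewrite ler_pdivrMr// mulrC -ler_pdivrMr.
  move=> cbt; have t0 : 0 < t by apply: lt_le_trans cbt; rewrite divr_gt0.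
  by rewrite divr_gt0//= ler_pdivrMr// mulrC -ler_pdivrMr.
have cb0 : 0 < c / b by rewrite divr_gt0.
transitivity (\int[mu]_(t in `[(c / b)%R, +oo[) (c / t ^+ 2)%:E)%E.
  apply: eq_integral => t /set_mem/=; rewrite in_itv/= andbT => cbt.
  by rewrite /w patchE mem_set//= in_itv/= andbT (lt_le_trans _ cbt).
have dF (t : R) : 0 < t ->
    is_derive t 1 (fun t => - (c * t^-1)) (c / t ^+ 2).
  move=> t0; have t_neq0 : t != 0 by rewrite gt_eqF.
  apply: is_derive_eq.
    by apply: is_deriveN; apply: is_deriveZ; exact: is_deriveV.
  rewrite /GRing.scale/=.
  by field.
(* The antiderivative - c / t tends to 0 at infinity and equals - b at c / b. *)
rewrite (@ge0_continuous_FTC2y _ _ (fun t => - (c * t^-1)) _ 0).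
- by rewrite -EFinB sub0r opprK invf_div mulrCA divff ?mulr1// gt_eqF.
- by move=> t ct; rewrite divr_ge0// ?ltW// exprn_gt0// (lt_le_trans _ ct).
- apply: continuous_in_subspaceT => t /set_mem/=; rewrite in_itv/= andbT => ct.
  have t0 : t ^+ 2 != 0 by rewrite expf_neq0// gt_eqF// (lt_le_trans _ ct).
  apply: cvgM; first exact: cvg_cst.
  by apply: cvgV => //; exact: exprn_continuous.
- rewrite -[X in _ --> X]oppr0 -[X in - X](mulr0 c).
  apply: cvgN; apply: cvgM; first exact: cvg_cst.
  apply/gtr0_cvgV0; last exact: cvg_id.
  by near=> t; near: t; exact: nbhs_pinfty_gt.
- by move=> t ct; have [] := dF t (lt_trans cb0 ct).
- apply: cvgN; apply: cvgM; first exact: cvg_cst.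
  apply: cvgV; first by rewrite gt_eqF.
  exact/cvg_at_right_filter/cvg_id.
- move=> t; rewrite in_itv/= andbT => ct; rewrite derive1E.
  by have [_ ->] := dF t (lt_trans cb0 ct).
Unshelve. all: by end_near. Qed.

Let nu_le0 (A : set R) : A `<=` `]-oo, 0]%classic -> nu A = 0%E.
Proof.
move=> A0; rewrite /nu/= /pushforward/= /mdensity integral0_eq// => t /A0/=.
rewrite in_itv/= /phi /w patchE => ct0; case: ifPn => // /set_mem/=.
by rewrite in_itv/= andbT => t0; move: ct0; rewrite leNgt divr_gt0.
Qed.

(** Uniqueness of Lebesgue measure concerns measures on the whole line, so [nu] is first completed
    by Lebesgue measure on the nonpositive half-line. The sum is then compared with length on the
    intervals ]a, b]. *)
Let lebesgue_nu (A : set R) : measurable A -> A `<=` `]0, +oo[%classic ->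
  mu A = nu A.
Proof.
move=> mA A0.
have mitv (i : interval R) : measurable ([set` i] : set (measurableTypeR R)).
  exact: measurable_itv.
pose N : set R := `]-oo, 0]%classic.
pose m := measure_add nu (mrestr mu (mitv `]-oo, 0])).
have mE (B : set R) : m B = (nu B + mu (B `&` N))%E by exact: measure_addE.
have -> : nu A = m A.
  rewrite mE; suff -> : A `&` N = set0 by rewrite measure0 adde0.
  rewrite -subset0 /N => x [/A0]/=; rewrite !in_itv/= andbT.
  by move=> x0; rewrite leNgt x0.
apply: lebesgue_measure_unique => // _ [[a b]] _ <-/=.
rewrite -[RHS]/(m _) mE; have [ab|ba] := ltP a b; last first.
  by rewrite set_itv_ge ?bnd_simp -?leNgt// set0I !measure0 adde0.
have nuU x y z : x <= y -> y <= z ->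
    nu `]x, z]%classic = (nu `]x, y]%classic + nu `]y, z]%classic)%E.
  move=> xy yz; rewrite -measureU//; first by rewrite -itv_bndbnd_setU ?bnd_simp.
  rewrite -subset0 => t []/=; rewrite !in_itv/= => /andP[_ ty] /andP[].
  by rewrite ltNge ty.
(* Three positions of 0: to the right of the interval, inside it, or to its left. In the last one
   the length is the difference of the values on ]0, b] and ]0, a]. *)
have [b0|b0] := leP b 0.
  have abN : `]a, b]%classic `<=` N.
    by rewrite /N => x/=; rewrite !in_itv/= => /andP[_ /le_trans]; exact.
  by rewrite nu_le0// add0e; congr (mu _); apply/esym/setIidPl.
have [a0|a0] := leP a 0.
  rewrite (nuU _ 0)//; last exact: ltW.
  rewrite nu_oc// nu_le0 ?add0e; last first.
    by move=> x/=; rewrite !in_itv/= => /andP[].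
  have -> : `]a, b]%classic `&` N = `]a, 0]%classic.
    apply/seteqP; rewrite /N; split => x/=; rewrite !in_itv/=.
      by move=> [/andP[-> _] ->].
    by move=> /andP[-> x0]; split => //; rewrite (le_trans x0)// ltW.
  rewrite !lebesgue_measure_itv/= !lte_fin ab.
  case: ltgtP a0 => // [a0 _|-> _]; last by rewrite adde0 -EFinB subr0.
  by rewrite -EFinB -EFinD sub0r.
have -> : `]a, b]%classic `&` N = set0.
  rewrite -subset0 /N => x []/=; rewrite !in_itv/= => /andP[ax _].
  by rewrite leNgt (lt_trans a0 ax).
rewrite measure0 adde0 lebesgue_measure_itv/= lte_fin ab.
have := nu_oc b0; rewrite (nuU _ a) ?ltW// nu_oc// => <-.
by rewrite addeAC subee// add0e.
Qed.

Lemma ge0_integral_inversion (g : R -> \bar R) :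
  measurable_fun setT g -> (forall x, 0 <= g x)%E ->
  (\int[mu]_(x in `]0%R, +oo[) g x =
   \int[mu]_(t in `]0%R, +oo[) (g (c / t)%R * (c / t ^+ 2)%:E))%E.
Proof.
move=> mg g0.
rewrite (eq_measure_integral nu); last by move=> A mA A0; exact: lebesgue_nu.
rewrite /nu ge0_integral_pushforward//=; last exact: measurable_funTS.
have mD : measurable (phi @^-1` `]0, +oo[).
  by rewrite -[X in measurable X]setTI; exact: mphi.
rewrite integral_mkcond ge0_integral_mdensity; last 2 first.
- apply: (measurable_restrictT _ _).1 => //; apply: measurable_funTS.
  exact: measurableT_comp.
- by move=> t; rewrite patchE; case: ifPn.
rewrite [RHS]integral_mkcond; apply: eq_integral => t _.
rewrite /w !patchE; have [/set_mem/=|/negP] := boolP (t \in `]0, +oo[%classic).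
  rewrite in_itv/= andbT => t0; rewrite mem_set//=.
  by rewrite in_itv/= andbT divr_gt0.
by rewrite mule0.
Qed.
End inversion.

(** * Tonelli's theorem on rectangles, by extension with 0 *)

Section tonelli_setX.
Local Open Scope ereal_scope.
Context d1 d2 (T1 : measurableType d1) (T2 : measurableType d2) (R : realType).
Variables (m1 : {sigma_finite_measure set T1 -> \bar R})
  (m2 : {sigma_finite_measure set T2 -> \bar R}).
Variables (D1 : set T1) (D2 : set T2) (H : T1 * T2 -> \bar R).
Hypotheses (mD1 : measurable D1) (mD2 : measurable D2)
  (mH : measurable_fun setT H) (H0 : forall z, 0 <= H z).

Let mHD : measurable_fun setT (H \_ (D1 `*` D2)).
Proof.
apply: (measurable_restrictT _ _).1; first exact: measurableX.
exact: measurable_funTS.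
Qed.

Let HD0 z : 0 <= (H \_ (D1 `*` D2)) z.
Proof. by rewrite patchE; case: ifPn. Qed.

Lemma fubini_tonelli_setX1 : \int[m1 \x m2]_(z in D1 `*` D2) H z =
  \int[m1]_(x in D1) \int[m2]_(y in D2) H (x, y).
Proof.
rewrite integral_mkcond fubini_tonelli1// [RHS]integral_mkcond.
apply: eq_integral => x _; rewrite /fubini_F patchE.
case: ifPn => [/set_mem D1x|/negP D1x].
  rewrite [RHS]integral_mkcond; apply: eq_integral => y _; rewrite !patchE.
  have [/set_mem D2y|/negP D2y] := boolP (y \in D2); first by rewrite mem_set.
  by rewrite memNset// => -[_ /mem_set].
rewrite integral0_eq// => y _; rewrite patchE memNset// => -[/mem_set].
by [].
Qed.

Lemma fubini_tonelli_setX2 : \int[m1 \x m2]_(z in D1 `*` D2) H z =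
  \int[m2]_(y in D2) \int[m1]_(x in D1) H (x, y).
Proof.
rewrite integral_mkcond fubini_tonelli2// [RHS]integral_mkcond.
apply: eq_integral => y _; rewrite /fubini_G patchE.
case: ifPn => [/set_mem D2y|/negP D2y].
  rewrite [RHS]integral_mkcond; apply: eq_integral => x _; rewrite !patchE.
  have [/set_mem D1x|/negP D1x] := boolP (x \in D1); first by rewrite mem_set.
  by rewrite memNset// => -[/mem_set].
rewrite integral0_eq// => x _; rewrite patchE memNset// => -[_ /mem_set].
by [].
Qed.

Lemma measurable_fun_integral_setr :
  measurable_fun setT (fun x => \int[m2]_(y in D2) H (x, y)).
Proof.
rewrite (_ : (fun _ => _) = fubini_F m2 (H \_ (setT `*` D2))).
  apply: measurable_fun_fubini_tonelli_F => [|z]; last first.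
    by rewrite patchE; case: ifPn.
  apply: (measurable_restrictT _ _).1; first exact: measurableX.
  exact: measurable_funTS.
apply/funext => x; rewrite /fubini_F [LHS]integral_mkcond.
apply: eq_integral => y _; rewrite !patchE.
have [/set_mem D2y|/negP D2y] := boolP (y \in D2); first by rewrite mem_set.
by rewrite memNset// => -[_ /mem_set].
Qed.

End tonelli_setX.

(** * Integration over the quadrant in ratio coordinates *)

Section ratio_coordinates.
Context {R : realType}.
Local Notation mu := (@lebesgue_measure R).

(** Scaling is the composition of the inversions x = b / t and t = 1 / s. *)
Lemma ge0_integral_scale (b : R) (g : R -> \bar R) : 0 < b ->
  measurable_fun setT g -> (forall x, 0 <= g x)%E ->
  (\int[mu]_(x in `]0%R, +oo[) g x =
   \int[mu]_(s in `]0%R, +oo[) (g (b * s)%R * b%:E))%E.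
Proof.
move=> b0 mg g0.
rewrite (ge0_integral_inversion b0)//.
rewrite (ge0_integral_inversion (@ltr01 R)); last 2 first.
- apply: emeasurable_funM.
    apply: measurableT_comp => //; apply: measurable_funM => //.
    exact: measurable_invr.
  apply/measurable_EFinP; apply: measurable_funM => //.
  by apply: measurableT_comp; [exact: measurable_invr|exact: measurable_funX].
- by move=> x; rewrite mule_ge0// lee_fin divr_ge0 ?sqr_ge0 ?ltW.
apply: eq_integral => s /set_mem/=; rewrite in_itv/= andbT => s0.
rewrite -muleA -EFinM div1r invrK; congr (_ * _%:E)%E.
by field; rewrite gt_eqF.
Qed.

(** For fixed second coordinate y, substitute x = y / t with Jacobian y / t^2. After exchanging the
    integrals, y = b s contributes the remaining factor b. *)
Lemma integral_ratio_coordinates (b : R) (G : R * R -> R) : 0 < b ->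
  measurable_fun setT G -> (forall z, 0 <= G z) ->
  (\int[mu \x mu]_(z in (`]0%R, +oo[ `*` `]0%R, +oo[)%classic) (G z)%:E =
   \int[mu]_(t in `]0%R, +oo[) \int[mu]_(s in `]0%R, +oo[)
     (G (b * s / t, b * s)%R * (b ^+ 2 * s / t ^+ 2))%:E)%E.
Proof.
move=> b0 mG G0.
have mI : measurable (`]0%R, +oo[%classic : set (measurableTypeR R)).
  exact: measurable_itv.
rewrite fubini_tonelli_setX2//; last first.
  exact/measurable_EFinP.
(* The absolute value makes the integrand nonnegative everywhere, as Tonelli requires; it disappears
   on the quadrant. *)
pose H (z : R * R) := (G (z.2 / z.1, z.2) * `|z.2 / z.1 ^+ 2|)%:E.
have mH : measurable_fun setT H.
  apply/measurable_EFinP; apply: measurable_funM.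
    apply: measurableT_comp => //; apply: measurable_fun_pair => //.
    apply: measurable_funM => //.
    by apply: measurableT_comp => //; exact: measurable_invr.
  apply: measurableT_comp => //; apply: measurable_funM => //.
  apply: measurableT_comp; first exact: measurable_invr.
  exact: measurable_funX.
have H0 z : (0 <= H z)%E by rewrite lee_fin mulr_ge0.
transitivity (\int[mu]_(y in `]0%R, +oo[) \int[mu]_(t in `]0%R, +oo[)
    H (t, y))%E.
  apply: eq_integral => y /set_mem/=; rewrite in_itv/= andbT => y0.
  rewrite (ge0_integral_inversion y0)//; last 2 first.
  - by apply/measurable_EFinP; apply: measurableT_comp.
  - by move=> x; rewrite lee_fin.
  apply: eq_integral => t _; rewrite /H/= -EFinM ger0_norm//.
  by rewrite divr_ge0 ?sqr_ge0// ltW.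
rewrite -fubini_tonelli_setX2// fubini_tonelli_setX1//.
apply: eq_integral => t /set_mem/=; rewrite in_itv/= andbT => t0.
rewrite (ge0_integral_scale b0)//; last exact: measurableT_comp.
apply: eq_integral => s /set_mem/=; rewrite in_itv/= andbT => s0.
rewrite /H/= -EFinM ger0_norm; last by rewrite divr_ge0 ?sqr_ge0// mulr_ge0 ?ltW.
by congr (_%:E); ring.
Qed.

End ratio_coordinates.

(** * Medians *)

Section median.
Local Open Scope ereal_scope.
Context d (T : measurableType d) (R : realType) (P : probability T R).

(** The witness is the infimum of the points where the distribution function has reached 1/2. Right
    continuity bounds the left mass there; strictly below it the function is under 1/2, which bounds
    the right mass in the limit. *)
Lemma exists_median_le (X : {RV P >-> R}) (x : R) : (2^-1)%:E <= cdf X x ->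
  exists2 m, (m <= x)%R & is_median (distribution P X) m.
Proof.
move=> xF; pose S := [set y | (2^-1)%:E <= cdf X y].
have S0 : S !=set0 by exists x.
(* The distribution function tends to 0 at -oo, so [S] is bounded below. *)
have [b Fb] : exists b, cdf X b < (2^-1)%:E.
  apply: contrapT => /forallNP Fge.
  have /cvge_ge/(_ (@cvg_cdfNy0 _ _ _ P X)) : \forall b \near -oo%R,
    (2^-1)%:E <= cdf X b by near=> b; rewrite leNgt; exact/negP/Fge.
  by rewrite lee_fin invr_le0 lern0.
have lbS : lbound S b.
  move=> y /= yF; rewrite leNgt; apply/negP => /ltW yb.
  by have := le_lt_trans (le_trans yF (cdf_nondecreasing X yb)) Fb; rewrite ltxx.
have iS : has_inf S by split => //; exists b.
exists (inf S); first exact: (@ge_inf _ S iS.2).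
split.
  apply: (cvge_ge _ (@cdf_right_continuous _ _ _ P X (inf S))).
  near=> r; have /(inf_lt S0)[y yF yr] : (inf S < r)%R.
    by near: r; exact: nbhs_right_gt.
  exact: (le_trans yF (cdf_nondecreasing X (ltW yr))).
have ltF r : (r < inf S)%R -> (2^-1)%:E <= ccdf X r.
  move=> rS; have Fr : cdf X r < (2^-1)%:E.
    by rewrite ltNge; apply/negP => /(@ge_inf _ S iS.2); rewrite leNgt rS.
  rewrite ccdf_1_cdf leeBrDr ?fin_num_measure//.
  rewrite (le_trans (leeD2l _ (ltW Fr)))// -EFinD lee_fin; lra.
(* The closed ray is a decreasing intersection of open rays starting below [inf S], each of mass at
   least 1/2. *)
rewrite itvcyEbigcap.
pose F n : set R := `](inf S - n.+1%:R^-1)%R, +oo[%classic.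
have mF n : measurable (F n) by exact: measurable_itv.
suff cF : distribution P X \o F @ \oo --> distribution P X (\bigcap_n F n).
  by apply: (cvge_ge _ cF); near=> n; apply: ltF; rewrite ltrBlDr ltrDl.
apply: nonincreasing_cvg_mu => //.
- by apply: (@le_lt_trans _ _ 1); [exact: probability_le1|rewrite ltry].
- exact: bigcap_measurable.
- move=> m n mn; apply/subsetPset; apply: subset_itvr.
  by rewrite bnd_simp lerD2l lerN2 lef_pV2 ?posrE// ler_nat.
Unshelve. all: by end_near. Qed.

(** Reflection X |-> - X turns this into the previous lemma. *)
Lemma exists_median_ge (X : {RV P >-> R}) (x : R) :
  (2^-1)%:E <= distribution P X `[x, +oo[ ->
  exists2 m, (x <= m)%R & is_median (distribution P X) m.
Proof.
move=> xF; pose Y : {RV P >-> R} := (- X)%R.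
have YE (A : set R) : distribution P Y A = distribution P X (-%R @^-1` A) by [].
have [|m mx [mY1 mY2]] := @exists_median_le Y (- x)%R.
  rewrite /cdf YE (_ : _ @^-1` _ = `[x, +oo[%classic)//.
  by apply/seteqP; split=> y /=; rewrite !in_itv/= andbT lerN2.
exists (- m)%R; first by rewrite lerNr.
move: mY1 mY2; rewrite !YE => mY1 mY2; split.
  rewrite (_ : `]-oo, (- m)%R]%classic = -%R @^-1` `[m, +oo[%classic)//.
  by apply/seteqP; split=> y /=; rewrite !in_itv/= andbT lerNr.
rewrite (_ : `[(- m)%R, +oo[%classic = -%R @^-1` `]-oo, m]%classic)//.
by apply/seteqP; split=> y /=; rewrite !in_itv/= andbT lerNl.
Qed.

Lemma exists_median (X : {RV P >-> R}) :
  exists m, is_median (distribution P X) m.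
Proof.
have [b Fb] : exists b, (2^-1)%:E <= cdf X b.
  apply: contrapT => /forallNP Flt.
  have /cvge_le/(_ (@cvg_cdfy1 _ _ _ P X)) : \forall b \near +oo%R,
    cdf X b <= (2^-1)%:E by near=> b; rewrite leNgt; apply/negP => /ltW/Flt.
  by rewrite lee_fin leNgt invf_lt1 ?ltr0n// ltr1n.
by have [m _ mP] := exists_median_le Fb; exists m.
Unshelve. all: by end_near. Qed.

(** Taking [x] strictly below [l] matters: a point mass at [l] leaves nothing to the right of
    [l]. *)
Lemma lt_le_medians (X : {RV P >-> R}) (l x : R) :
  (forall m, is_median (distribution P X) m -> (l <= m)%R) -> (x < l)%R ->
  (2^-1)%:E < distribution P X `]x, +oo[.
Proof.
move=> lm xl; rewrite ltNge; apply/negP => xF.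
have [|m mx /lm lem] := @exists_median_le X x.
  rewrite cdf_1_ccdf leeBrDr ?fin_num_measure//.
  rewrite (le_trans (leeD2l _ xF))// -EFinD lee_fin; lra.
by have := lt_le_trans xl (le_trans lem mx); rewrite ltxx.
Qed.

Lemma gt_ge_medians (X : {RV P >-> R}) (u x : R) :
  (forall m, is_median (distribution P X) m -> (m <= u)%R) -> (u < x)%R ->
  (2^-1)%:E < distribution P X `]-oo, x[.
Proof.
move=> um ux; rewrite ltNge; apply/negP => xF.
have [|m mx /um leu] := @exists_median_ge X x.
  rewrite -setCitvl probability_setC//.
  rewrite leeBrDr ?fin_num_measure//.
  rewrite (le_trans (leeD2l _ xF))// -EFinD lee_fin; lra.
by have := le_lt_trans (le_trans mx leu) ux; rewrite ltxx.
Qed.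

End median.

(** * Comparison of the losses *)

(** Preimages of the rays [r, +oo[ within an interval are again intervals. *)
Lemma nondecreasing_in_measurable (R : realType) (D : set R) (f : R -> R) :
  is_interval D -> {in D &, {homo f : x y / x <= y}} -> measurable_fun D f.
Proof.
move=> iD f_nd; have mD := is_interval_measurable iD.
apply: (measurability (@RGenCInfty.G R)) => [|/= _ [_] [r] -> <-].
  exact: RGenCInfty.measurableE.
apply: is_interval_measurable => s t/=.
rewrite !in_itv/= !andbT => -[Ds fs] [Dt ft] u sut.
have Du : D u by exact: (iD s t).
split=> //; rewrite in_itv/= andbT (le_trans fs)// f_nd ?inE//.
by case/andP : sut.
Qed.

Lemma probability_setIr_full d (T : measurableType d) (R : realType)
    (P : probability T R) (A B : set T) : measurable A -> measurable B ->
  P B = 1%E -> P (A `&` B) = P A.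
Proof.
move=> mA mB PB; rewrite [RHS](measureDI P mA mB).
rewrite [X in (X + _)%E](_ : _ = 0%E) ?add0e//.
apply: (@subset_measure0 _ _ _ P _ (~` B)); first exact: measurableD.
- exact: measurableC.
- by move=> x [].
- by rewrite /= probability_setC// PB subee.
Qed.

Section measurable_comparison.
Context d (T : measurableType d) (R : realType) (f g : T -> R).
Hypotheses (mf : measurable_fun setT f) (mg : measurable_fun setT g).

Lemma measurable_set_ltr : measurable [set x | f x < g x].
Proof.
rewrite -[X in measurable X]setTI; under eq_set do rewrite -lte_fin.
by apply: measurable_lte => //; exact/measurable_EFinP.
Qed.

Lemma measurable_set_ler : measurable [set x | f x <= g x].
Proof.
rewrite -[X in measurable X]setTI; under eq_set do rewrite -lee_fin.
by apply: measurable_lee => //; exact/measurable_EFinP.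
Qed.

Lemma measurable_set_eqr : measurable [set x | f x = g x].
Proof.
rewrite (_ : [set x | _] = [set x | (f x)%:E = (g x)%:E]); last first.
  by apply/seteqP; split => x /= => [->|[]].
rewrite -[X in measurable X]setTI.
by apply: measurable_eqe => //; exact/measurable_EFinP.
Qed.

End measurable_comparison.

(** * Monotonicity and continuity of the loss *)

Section general_loss.
Context {R : realType} (W : R -> R).
Hypothesis hW : general_loss W.

(** Strict decrease is assumed on the open interval only. The endpoint 1 is reached through a
    midpoint, where [W] is nonnegative and already below [W x]. *)
Lemma general_loss_ltl x y : 0 < x -> x < y -> y <= 1 -> W y < W x.
Proof.
case: hW => W1 W0 Wd _ x0 xy; rewrite le_eqVlt => /predU1P[y1|]; last exact: Wd.
have xm : x < (x + 1) / 2 by lra.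
have m1 : (x + 1) / 2 < 1 by lra.
have m0 : 0 < (x + 1) / 2 by lra.
by rewrite y1 W1 (le_lt_trans (W0 _ m0))// Wd.
Qed.

Lemma general_loss_ltr x y : 1 <= x -> x < y -> W x < W y.
Proof.
case: hW => W1 W0 _ Wi; rewrite le_eqVlt => /predU1P[<- y1|]; last exact: Wi.
have m1 : 1 < (1 + y) / 2 by lra.
have ym : (1 + y) / 2 < y by lra.
have m0 : 0 < (1 + y) / 2 by lra.
by rewrite W1 (le_lt_trans (W0 _ m0))// Wi.
Qed.

(** [W] is monotone on each of ]0, 1] and ]1, +oo[. *)
Lemma measurable_general_loss : measurable_fun setT (W \_ `]0, +oo[).
Proof.
apply: (measurable_restrictT _ _).1 => //.
have -> : `]0%R, +oo[%classic =
    `]0%R, 1%R]%classic `|` `]1%R, +oo[%classic :> set R.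
  by rewrite -itv_bndbnd_setU ?bnd_simp.
apply/measurable_funU => //; split.
  rewrite -[W]opprK; apply/measurable_funN.
  apply: nondecreasing_in_measurable => [|x y]; first exact: interval_is_interval.
  rewrite !inE/= !in_itv/= => /andP[x0 _] /andP[_ y1].
  rewrite le_eqVlt => /predU1P[->//|xy].
  by rewrite lerN2 ltW// general_loss_ltl.
apply: nondecreasing_in_measurable => [|x y]; first exact: interval_is_interval.
rewrite !inE/= !in_itv/= !andbT => x1 _.
by rewrite le_eqVlt => /predU1P[->//|xy]; rewrite ltW// general_loss_ltr// ltW.
Qed.

Hypothesis cW : {for 1, continuous W}.

Lemma general_loss_near1 (y : R) : 0 < W y ->
  exists2 e, 0 < e & forall r, `|1 - r| < e -> W r < W y.
Proof.
case: hW => W1 _ _ _ Wy.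
have : \forall r \near (1 : R), W r < W y.
  by move/cvgr_lt : cW; apply; rewrite W1.
by move=> /nbhs_ballP[e /= e0 eP]; exists e.
Qed.

(* Continuity of [W] at 1 extends the comparison slightly below [s = l], where
   [W (s / l)] is close to 0 while [W (s / m)] stays away from 0. *)
Lemma general_loss_closer_above m l : 0 < m -> m < l ->
  exists x, [/\ 0 <= x, x < l & forall s, x < s -> W (s / l) < W (s / m)].
Proof.
move=> m0 ml; have l0 : 0 < l by lra.
pose k := l / m; have k1 : 1 < k by rewrite /k ltr_pdivlMr// mul1r.
(* [W rho] separates the two losses. With r = s / l, the condition r > rho / k puts s / m = r k
   beyond [rho], and r > 1 - e keeps [W r] under [W rho] when r < 1. For r >= 1 monotonicity
   suffices. *)
pose rho := (1 + k) / 2; have rho1 : 1 < rho by rewrite /rho; lra.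
have rhok : rho / k < 1 by rewrite ltr_pdivrMr /rho; lra.
have Wrho : 0 < W rho by case: hW => <- _ _ _; exact: general_loss_ltr.
have [e e0 eW] := general_loss_near1 Wrho.
exists (l * Num.max (1 - e) (rho / k)); split.
- by rewrite mulr_ge0 ?ltW// lt_max divr_gt0 ?orbT//; lra.
- by rewrite gtr_pMr// gt_max rhok andbT; lra.
move=> s; rewrite mulrC -ltr_pdivlMr// gt_max => /andP[].
rewrite (_ : s / m = s / l * k); last by rewrite /k; field; lra.
set r := s / l; rewrite ltr_pdivrMr; last by lra.
move=> re rk; have [r1|r1] := leP 1 r.
  by apply: general_loss_ltr => //; rewrite ltr_pMr//; lra.
apply: (@lt_trans _ _ (W rho)); last by apply: general_loss_ltr => //; exact: ltW.
by apply: eW; rewrite ger0_norm; lra.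
Qed.

(** Mirror image of the preceding lemma. Positivity of s is now assumed, since a bound from above
    does not keep s in the domain where [W] is controlled. *)
Lemma general_loss_closer_below m u : 0 < u -> u < m ->
  exists2 x, u < x & forall s, 0 < s -> s < x -> W (s / u) < W (s / m).
Proof.
move=> u0 um; have m0 : 0 < m by lra.
pose k := u / m; have k1 : k < 1 by rewrite /k ltr_pdivrMr// mul1r.
have k0 : 0 < k by rewrite divr_gt0.
pose rho := (1 + k) / 2; have rho1 : rho < 1 by rewrite /rho; lra.
have rho0 : 0 < rho by rewrite /rho; lra.
have rhok : 1 < rho / k by rewrite ltr_pdivlMr// /rho; lra.
have Wrho : 0 < W rho by case: hW => <- _ _ _; exact: general_loss_ltl.
have [e e0 eW] := general_loss_near1 Wrho.
exists (u * Num.min (1 + e) (rho / k)).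
  by rewrite ltr_pMr// lt_min rhok andbT; lra.
move=> s s0; rewrite mulrC -ltr_pdivrMr// lt_min => /andP[].
rewrite (_ : s / m = s / u * k); last by rewrite /k; field; lra.
have : 0 < s / u by rewrite divr_gt0.
set r := s / u => r0 re; rewrite ltr_pdivlMr// => rk.
have [r1|r1] := leP r 1.
  by apply: general_loss_ltl => //; [exact: mulr_gt0|nra].
apply: (@lt_trans _ _ (W rho)); last first.
  by apply: general_loss_ltl => //; [exact: mulr_gt0|exact: ltW].
by apply: eW; rewrite distrC ger0_norm; lra.
Qed.

End general_loss.

Lemma xi_star_between (R : realType) (m0 : R) (l u : R -> R) (t : R) :
  0 < m0 -> 0 < l t -> l t <= m0 -> m0 <= u t -> xi_star m0 l u t = m0^-1.
Proof.
move=> m0_gt0 lt0 lm mu; have ut0 := lt_le_trans m0_gt0 mu.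
by rewrite /xi_star min_l ?max_r// lef_pV2.
Qed.

(** * Comparison of the estimators under a fixed law of Z2 *)

Section closer_than_median.
Context d (T : measurableType d) (R : realType) (P : probability T R)
  (X : {RV P >-> R}) (W : R -> R) (m0 l u : R).
Hypotheses (hW : general_loss W) (cW : {for 1, continuous W}) (m0_gt0 : 0 < m0).
Hypotheses (X_gt0 : distribution P X `]0, +oo[%classic = 1%E) (l_gt0 : 0 < l).
Hypothesis lu :
  forall m, is_median (distribution P X) m -> l <= m /\ m <= u.

Local Notation LW := (W \_ `]0, +oo[%classic).
Local Notation xi := (Num.max u^-1 (Num.min m0^-1 l^-1)).

Let lt_set : set R := [set s | LW (xi * s) < LW (s / m0)].

Let LWE s : 0 < s -> LW s = W s.
Proof. by move=> s0; rewrite patchE mem_set//= in_itv/= andbT. Qed.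

(** Some median exists and lies between the two bounds. Hence 1 / u <= 1 / l, so the outer maximum
    in [xi] leaves 1 / l unchanged. *)
Let l_le_u : l <= u.
Proof. by have [m /lu[lm mu]] := exists_median X; exact: le_trans mu. Qed.

Let u_gt0 : 0 < u. Proof. exact: lt_le_trans l_le_u. Qed.

Let measurable_LW_scale (a : R) : measurable_fun setT (fun s => LW (a * s)).
Proof. by apply: measurableT_comp; first exact: measurable_general_loss. Qed.

Let measurable_lt_set : measurable lt_set.
Proof.
apply: measurable_set_ltr; first exact: measurable_LW_scale.
by under eq_fun do rewrite mulrC; exact: measurable_LW_scale.
Qed.

Lemma closer_off_median : ~ (l <= m0 /\ m0 <= u) ->
  ((2^-1)%:E < distribution P X lt_set)%E.
Proof.
move=> /not_andP nlu; have [lm|ml] := leP l m0.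
  have um : u < m0 by case: nlu => [/(_ lm)//|/negP]; rewrite -ltNge.
  have xiE : xi = u^-1.
    by rewrite max_l// ge_min lef_pV2 ?posrE// ltW.
  have [x ux xW] := general_loss_closer_below hW cW u_gt0 um.
  apply: (@lt_le_trans _ _ (distribution P X `]-oo, x[)).
    by apply: gt_ge_medians ux => m /lu[].
  (* The law is carried by the positive half-line, the only place where the losses are compared. *)
  have -> : distribution P X `]-oo, x[%classic =
            distribution P X (`]-oo, x[%classic `&` `]0, +oo[%classic).
    by rewrite probability_setIr_full.
  apply: le_measure; rewrite ?inE//; first exact: measurableI.
  move=> s []; rewrite /lt_set /= !in_itv/= andbT => sx s0.
  by rewrite xiE !LWE ?mulr_gt0 ?invr_gt0// mulrC xW.
have [x [x0 xl xW]] := general_loss_closer_above hW cW m0_gt0 ml.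
have xiE : xi = l^-1.
  by rewrite min_r ?max_r// lef_pV2 ?posrE// ltW.
apply: (@lt_le_trans _ _ (distribution P X `]x, +oo[)).
  by apply: lt_le_medians xl => m /lu[].
apply: le_measure; rewrite ?inE// => s; rewrite /lt_set /= in_itv/= andbT => xs.
have s0 := le_lt_trans x0 xs.
by rewrite xiE !LWE ?mulr_gt0 ?invr_gt0// mulrC xW.
Qed.

End closer_than_median.

(** * Conditioning on the ratio *)

(** The excess of [g] over [f] has integral 0, because adding it to [f] gives almost everywhere at
    most [g], whose integral does not exceed the finite integral of [f]. This later turns a failure
    of strict inequality between integrals into a pointwise statement. *)
Lemma ae_le_of_integral_le d (T : measurableType d) (R : realType)
    (mu : {measure set T -> \bar R}) (D : set T) (f g : T -> \bar R) :
  measurable D -> measurable_fun D f -> measurable_fun D g ->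
  (forall x, D x -> 0 <= f x)%E -> (forall x, D x -> 0 <= g x)%E ->
  {ae mu, forall x, D x -> (f x <= g x)%E} ->
  (\int[mu]_(x in D) f x < +oo)%E ->
  (\int[mu]_(x in D) g x <= \int[mu]_(x in D) f x)%E ->
  {ae mu, forall x, D x -> (g x <= f x)%E}.
Proof.
move=> mD mf mg f0 g0 fg foo gf.
(* The difference is known to be nonnegative only almost everywhere; the maximum with 0 makes it so
   everywhere. *)
pose e x : \bar R := maxe (g x - f x)%E 0.
have me : measurable_fun D e.
  by apply: measurable_maxe => //; exact: emeasurable_funB.
have e0 x : (0 <= e x)%E by rewrite le_max lexx orbT.
have iff : mu.-integrable D f.
  apply/integrableP; split => //.
  by under eq_integral => x /set_mem Dx do rewrite gee0_abs ?f0//.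
have ffin : {ae mu, forall x, D x -> f x \is a fin_num} by exact: integrable_ae.
have ie : (\int[mu]_(x in D) e x = 0)%E.
  apply/eqP; rewrite eq_le integral_ge0// andbT.
  have fD : (\int[mu]_(x in D) f x \is a fin_num)%E.
    by rewrite ge0_fin_numE ?integral_ge0.
  rewrite -(leeD2lE _ _ fD) adde0 -ge0_integralD//.
  apply: le_trans gf; apply: ae_ge0_le_integral => //.
  - by move=> x Dx; rewrite adde_ge0// f0.
  - exact: emeasurable_funD.
  near=> x => Dx.
  have fx : f x \is a fin_num by move: Dx; near: x.
  have fgx : (f x <= g x)%E by move: Dx; near: x.
  by rewrite /e max_l ?suber_ge0// addeC subeK.
have /(ae_eq_integral_abs mu mD me).1 : (\int[mu]_(x in D) `|e x| = 0)%E.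
  by rewrite -[RHS]ie; apply: eq_integral => x _; rewrite gee0_abs.
move=> ee0; near=> x => Dx.
have fx : f x \is a fin_num by move: Dx; near: x.
have : e x = 0%E by move: Dx; near: x; exact: ee0.
by move=> ex0; rewrite -sube_le0 -ex0 le_max lexx.
Unshelve. all: by end_near. Qed.

(** * The law of X sliced along D *)

Section ratio_model.
Context {R : realType}.
Local Notation mu := (@lebesgue_measure R).

(* The density of (D, Z2); it is only meaningful for positive coordinates, and
   the absolute value keeps it nonnegative elsewhere, as Tonelli requires. *)
Definition ratio_pdf (f : R * R -> R) (lam : R) (z : R * R) : R :=
  `|lam * z.2 / z.1 ^+ 2| * f (lam * z.2 / z.1, z.2).

(** For [c = theta.2] this recovers the sample point from the values (t, s) of (D, Z2). *)
Definition ratio_inv (c : R) (z : R * R) : R * R := (c * z.2 / z.1, c * z.2).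

(** The contribution of D = t to the probability of [A], left unnormalised so that it makes sense
    even where the density of D is 0 or infinite. *)
Definition slice_mass (f : R * R -> R) (theta : R * R) (A : set (R * R))
    (t : R) : \bar R :=
  (\int[mu]_(s in `]0%R, +oo[)
    ((ratio_pdf f (theta.2 / theta.1) \_ (ratio_inv theta.2 @^-1` A))
       (t, s))%:E)%E.

Lemma measurable_ratio_inv c : measurable_fun setT (ratio_inv c).
Proof.
apply: measurable_fun_pair; last exact: measurable_funM.
apply: measurable_funM; first exact: measurable_funM.
by apply: measurableT_comp; [exact: measurable_invr|].
Qed.

Variable f : R * R -> R.
Hypothesis hf : is_pdf2 f.

Let mf : measurable_fun setT f. Proof. by case: hf. Qed.
Let f0 z : 0 <= f z. Proof. by case: hf. Qed.

Lemma measurable_ratio_pdf lam : measurable_fun setT (ratio_pdf f lam).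
Proof.
apply: measurable_funM.
  apply: measurableT_comp => //; apply: measurable_funM.
    exact: measurable_funM.
  apply: measurableT_comp; first exact: measurable_invr.
  exact: measurable_funX.
apply: measurableT_comp => //; apply: measurable_fun_pair => //.
apply: measurable_funM; first exact: measurable_funM.
by apply: measurableT_comp; [exact: measurable_invr|].
Qed.

Lemma ratio_pdf_ge0 lam z : 0 <= ratio_pdf f lam z.
Proof. by rewrite mulr_ge0. Qed.

Section slice.
Variables (theta : R * R) (A : set (R * R)).
Hypothesis mA : measurable A.
Local Notation lam := (theta.2 / theta.1).
Local Notation fA := (ratio_pdf f lam \_ (ratio_inv theta.2 @^-1` A)).

Lemma measurable_ratio_inv_preimage : measurable (ratio_inv theta.2 @^-1` A).
Proof. by rewrite -[X in measurable X]setTI; exact: measurable_ratio_inv. Qed.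

Lemma measurable_slice : measurable_fun setT fA.
Proof.
apply: (measurable_restrictT _ _).1; first exact: measurable_ratio_inv_preimage.
by apply: measurable_funTS; exact: measurable_ratio_pdf.
Qed.

Lemma slice_ge0 z : 0 <= fA z.
Proof. by rewrite patchE; case: ifPn => // _; exact: ratio_pdf_ge0. Qed.

Lemma slice_mass_ge0 t : (0 <= slice_mass f theta A t)%E.
Proof. by apply: integral_ge0 => s _; rewrite lee_fin slice_ge0. Qed.

Lemma measurable_slice_mass : measurable_fun setT (slice_mass f theta A).
Proof.
apply: (@measurable_fun_integral_setr _ _ _ _ R mu `]0%R, +oo[%classic
  (fun z => (fA z)%:E)) => //.
- by apply/measurable_EFinP; exact: measurable_slice.
- by move=> z; rewrite lee_fin slice_ge0.
Qed.

End slice.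

Lemma slice_massT theta t : Theta0 theta -> 0 < t ->
  slice_mass f theta setT t = pdf_D f (theta.2 / theta.1) t.
Proof.
move=> [th1 th12] t0; have th2 : 0 < theta.2 by exact: lt_le_trans th12.
rewrite /slice_mass /pdf_D; apply: eq_integral => s.
move=> /set_mem/=; rewrite in_itv/= andbT => s0.
rewrite patchE mem_set// /ratio_pdf/= ger0_norm//.
by rewrite !mulr_ge0 ?invr_ge0 ?exprn_ge0 ?ltW.
Qed.

(** The second factor is the Jacobian of [ratio_inv theta.2], which identifies [ratio_pdf] as the
    density of (D, Z2). *)
Lemma joint_pdf_ratio_inv theta (t s : R) : Theta0 theta -> 0 < t -> 0 < s ->
  joint_pdf f theta (theta.2 * s / t, theta.2 * s) *
    (theta.2 ^+ 2 * s / t ^+ 2) = ratio_pdf f (theta.2 / theta.1) (t, s).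
Proof.
move=> [th1 th12] t0 s0; have th2 : 0 < theta.2 by exact: lt_le_trans th12.
rewrite /joint_pdf /ratio_pdf/= ger0_norm; last first.
  by rewrite !mulr_ge0 ?invr_ge0 ?exprn_ge0 ?ltW.
have -> : theta.2 * s / theta.2 = s by field; lra.
have -> : theta.2 * s / t / theta.1 = theta.2 / theta.1 * s / t by field; lra.
by field; lra.
Qed.

Lemma scale_model_ratio d (Omega : measurableType d)
    (P : R * R -> probability Omega R) (X : Omega -> R * R) theta A :
  measurable_fun setT X -> scale_model f P X -> Theta0 theta -> measurable A ->
  (P theta (X @^-1` A) = \int[mu]_(t in `]0%R, +oo[) slice_mass f theta A t)%E.
Proof.
move=> mX hX th mA; have [PE PQ] := hX theta th; have [th1 th12] := th.
have th2 : 0 < theta.2 by exact: lt_le_trans th12.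
pose Q : set (R * R) := `]0%R, +oo[%classic `*` `]0%R, +oo[%classic.
have mQ : measurable Q by apply: measurableX.
have mXP B : measurable B -> measurable (X @^-1` B).
  by move=> mB; rewrite -[X in measurable X]setTI; exact: mX.
(* X lies in the open quadrant almost surely, and the ratio coordinates are available there. *)
rewrite -(@probability_setIr_full _ _ _ _ _ (X @^-1` Q)); [|exact: mXP..|];
  last first.
  rewrite -[RHS]PQ; congr (P theta _).
  by apply/seteqP; split=> w; rewrite /Q/= !in_itv/= !andbT.
rewrite -preimage_setI PE; last exact: measurableI.
rewrite setIC integral_mkcondr.
pose G : R * R -> R := joint_pdf f theta \_ A.
transitivity (\int[mu \x mu]_(z in Q) (G z)%:E)%E.
  by apply: eq_integral => z _; rewrite /G restrict_EFin.
have mj : measurable_fun setT (joint_pdf f theta).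
  apply: measurable_funM => //; apply: measurableT_comp => //.
  by apply: measurable_fun_pair; apply: measurable_funM.
rewrite (integral_ratio_coordinates th2); last 2 first.
- by apply: (measurable_restrictT _ _).1 => //; exact: measurable_funTS.
- move=> z; rewrite /G patchE; case: ifPn => // _.
  by rewrite mulr_ge0// invr_ge0 mulr_ge0// ltW.
apply: eq_integral => t /set_mem/=; rewrite in_itv/= andbT => t0.
apply: eq_integral => s /set_mem/=; rewrite in_itv/= andbT => s0.
rewrite /G !patchE /=.
have -> : ((t, s) \in ratio_inv theta.2 @^-1` A) =
  ((theta.2 * s / t, theta.2 * s) \in A) by [].
case: ifPn => _; last by rewrite mul0r.
by rewrite joint_pdf_ratio_inv.
Qed.

End ratio_model.

(** * The conditional law of Z2 given D = t *)

Section conditional_law.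
Context {R : realType} (f : R * R -> R).
Local Notation mu := (@lebesgue_measure R).
Hypothesis hf : is_pdf2 f.

Lemma measurable_cond_pdf lam t : measurable_fun setT (cond_pdf_Z2 f lam t).
Proof.
have mf : measurable_fun setT f by case: hf.
apply: measurable_funM => //; apply: measurable_funM.
  by apply: measurable_funM => //; exact: measurable_funM.
apply: measurableT_comp => //; apply: measurable_fun_pair => //.
by apply: measurable_funM => //; exact: measurable_funM.
Qed.

Variables (theta : R * R) (t : R).
Hypothesis th : Theta0 theta.
Local Notation lam := (theta.2 / theta.1).
Hypothesis ht : supp_D f lam t.

Let t0 : 0 < t. Proof. by case: ht. Qed.
Let q0 : (0 < pdf_D f lam t)%E. Proof. by case: ht => _ /andP[]. Qed.
Let qoo : (pdf_D f lam t < +oo)%E. Proof. by case: ht => _ /andP[]. Qed.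
Let lam0 : 0 < lam.
Proof. by case: th => th1 th2; rewrite divr_gt0// (lt_le_trans th1). Qed.

Let qE : (fine (pdf_D f lam t))%:E = pdf_D f lam t.
Proof. by rewrite fineK// ge0_fin_numE// ltW. Qed.

Let q_gt0 : 0 < fine (pdf_D f lam t).
Proof. by rewrite fine_gt0// q0. Qed.

Let cond_pdfE s : 0 < s ->
  cond_pdf_Z2 f lam t s = ratio_pdf f lam (t, s) / fine (pdf_D f lam t).
Proof.
move=> s0; rewrite /cond_pdf_Z2 /ratio_pdf/= ger0_norm//.
by apply: divr_ge0; [apply: mulr_ge0; exact: ltW|exact: sqr_ge0].
Qed.

Let k : R -> R := cond_pdf_Z2 f lam t \_ `]0, +oo[.

Let mk : measurable_fun setT k.
Proof.
apply: (measurable_restrictT _ _).1 => //; apply: measurable_funTS.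
exact: measurable_cond_pdf.
Qed.

Let k0 s : 0 <= k s.
Proof.
rewrite /k patchE; case: ifPn => // /set_mem/=; rewrite in_itv/= andbT => s0.
by rewrite cond_pdfE//; apply: divr_ge0; [exact: ratio_pdf_ge0|exact: ltW].
Qed.

Let cond_lawE (A : set R) :
  cond_law_Z2 f lam t A = (\int[mu]_(s in A) (k s)%:E)%E.
Proof.
rewrite /cond_law_Z2 integral_mkcondr; apply: eq_integral => s _.
by rewrite /k restrict_EFin.
Qed.

(** The joint density factors as marginal times conditional density; [B] is the section of [A] at D
    = t, read in the coordinate Z2. *)
Lemma slice_mass_cond_law (A : set (R * R)) (B : set R) : measurable B ->
  (forall s, 0 < s -> A (theta.2 * s / t, theta.2 * s) <-> B s) ->
  slice_mass f theta A t = (pdf_D f lam t * cond_law_Z2 f lam t B)%E.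
Proof.
move=> mB AB; rewrite cond_lawE -qE [X in (_ * X)%E]integral_mkcond.
rewrite -ge0_integralZl_EFin ?ltW//; last 2 first.
- by move=> s _; rewrite patchE; case: ifPn => // _; rewrite lee_fin.
- apply: (measurable_restrictT _ _).1 => //; apply: measurable_funTS.
  exact/measurable_EFinP.
rewrite /slice_mass [LHS]integral_mkcond; apply: eq_integral => s _.
rewrite /k !patchE; have [/set_mem/=|_] := boolP (s \in `]0, +oo[%classic);
  last by case: ifPn; rewrite mule0.
rewrite in_itv/= andbT => s0.
have -> : ((t, s) \in ratio_inv theta.2 @^-1` A) = (s \in B).
  by apply/idP/idP => /set_mem sAB; apply/mem_set/(AB _ s0).
case: ifPn => _; last by rewrite mule0.
by rewrite -EFinM cond_pdfE// mulrCA divff ?mulr1 ?gt_eqF.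
Qed.

Lemma cond_lawT : cond_law_Z2 f lam t setT = 1%E.
Proof.
(* On the whole space the factorization reads q = q K, with K the total conditional mass; q is
   positive and finite, so K = 1. *)
have := @slice_mass_cond_law setT setT measurableT (fun _ _ => iff_refl _).
rewrite slice_massT// cond_lawE -qE.
have q_neq0 : fine (pdf_D f lam t) != 0 by rewrite gt_eqF.
have : (0 <= \int[mu]_s (k s)%:E)%E.
  by apply: integral_ge0 => s _; rewrite lee_fin.
case: (\int[mu]_s _)%E => [r _|_|//] /=; last by rewrite gt0_muley ?lte_fin.
rewrite -EFinM => -[/eqP]; rewrite -{1}[fine _]mulr1 (inj_eq (mulfI q_neq0)).
by move=> /eqP <-.
Qed.

(** Bundling the conditional law as a probability makes the results on medians applicable to it. *)
Lemma cond_law_probability : exists K : probability (measurableTypeR R) R,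
  K =1 cond_law_Z2 f lam t.
Proof.
have K1 : mdensity mu mk k0 setT = 1%E by rewrite -cond_lawT cond_lawE.
pose K : probability (measurableTypeR R) R :=
  HB.pack (mdensity mu mk k0) (Measure_isProbability.Build _ _ _ _ K1).
by exists K => A; rewrite cond_lawE.
Qed.

End conditional_law.

(** * Comparison of the estimators on each slice *)

Section comparison.
Context {R : realType} (f : R * R -> R) (W : R -> R) (m0 : R) (l u : R -> R).
Local Notation mu := (@lebesgue_measure R).
Hypotheses (hf : is_pdf2 f) (hW : general_loss W) (cW : {for 1, continuous W})
  (m0_gt0 : 0 < m0).
Hypotheses (mesl : measurable_fun setT l) (mesu : measurable_fun setT u).
Hypothesis hlu : forall lam t, 1 <= lam -> supp_D f lam t ->
  0 < l t /\ forall m, is_median (cond_law_Z2 f lam t) m -> l t <= m /\ m <= u t.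
Variable theta : R * R.
Hypothesis th : Theta0 theta.
Local Notation lam := (theta.2 / theta.1).
Local Notation LW := (W \_ `]0, +oo[%classic).
Local Notation d1 := (delta_scale (xi_star m0 l u)).
Local Notation d2 := (delta_PNSEE m0).

Definition better_set : set (R * R) :=
  [set x | L2 W theta (d1 x) < L2 W theta (d2 x)].
Definition tie_set : set (R * R) :=
  [set x | L2 W theta (d1 x) = L2 W theta (d2 x)].
(** Outside this set the two estimators coincide as soon as [l] is positive. *)
Definition off_set : set (R * R) :=
  ~` [set x | l (Dstat x) <= m0 /\ m0 <= u (Dstat x)].

Let th2 : 0 < theta.2. Proof. by case: th => th1; exact: lt_le_trans. Qed.

Let lam1 : 1 <= lam.
Proof. by case: th => th1 th12; rewrite ler_pdivlMr// mul1r. Qed.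

Lemma measurable_Dstat : measurable_fun setT (@Dstat R).
Proof.
apply: measurable_funM => //.
by apply: measurableT_comp; [exact: measurable_invr|].
Qed.

Let mxi : measurable_fun setT (xi_star m0 l u).
Proof.
apply: measurable_maxr; last apply: measurable_minr => //.
  by apply: measurableT_comp; [exact: measurable_invr|].
by apply: measurableT_comp; [exact: measurable_invr|].
Qed.

Let mL1 : measurable_fun setT (fun x => L2 W theta (d1 x)).
Proof.
apply: (measurableT_comp (measurable_general_loss hW)).
apply: measurable_funM => //; apply: measurable_funM => //.
by apply: measurableT_comp => //; exact: measurable_Dstat.
Qed.

Let mL2 : measurable_fun setT (fun x => L2 W theta (d2 x)).
Proof.
apply: (measurableT_comp (measurable_general_loss hW)).
by apply: measurable_funM => //; exact: measurable_funM.
Qed.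

Lemma measurable_better_set : measurable better_set.
Proof. exact: measurable_set_ltr. Qed.

Lemma measurable_tie_set : measurable tie_set.
Proof. exact: measurable_set_eqr. Qed.

Lemma measurable_off_set : measurable off_set.
Proof.
have mD := measurable_Dstat.
apply: measurableC; apply: measurableI.
  by apply: measurable_set_ler => //; exact: measurableT_comp.
by apply: measurable_set_ler => //; exact: measurableT_comp.
Qed.

Let Dstat_ratio_inv t s : 0 < t -> 0 < s ->
  Dstat (theta.2 * s / t, theta.2 * s) = t.
Proof. by move=> t0 s0; rewrite /Dstat/=; field; rewrite !gt_eqF. Qed.

Let L2_d1 t s : 0 < t -> 0 < s ->
  L2 W theta (d1 (theta.2 * s / t, theta.2 * s)) = LW (xi_star m0 l u t * s).
Proof.
move=> t0 s0; rewrite /L2 /delta_scale Dstat_ratio_inv//=; congr LW.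
by field; rewrite gt_eqF.
Qed.

Let L2_d2 t s : 0 < t -> 0 < s ->
  L2 W theta (d2 (theta.2 * s / t, theta.2 * s)) = LW (s / m0).
Proof.
by move=> t0 s0; rewrite /L2 /delta_PNSEE/=; congr LW; field; rewrite !gt_eqF.
Qed.

Let LWx t := measurableT_comp (measurable_general_loss hW)
  (@mulrl_measurable R setT (xi_star m0 l u t)).

Let LWm := measurableT_comp (measurable_general_loss hW)
  (@mulrr_measurable R setT m0^-1).

Local Notation q := (pdf_D f lam).
Local Notation G := (fun t => slice_mass f theta better_set t +
  (2^-1)%:E * slice_mass f theta tie_set t)%E.

(* [(t^-1, 1)] is just some point [x] with [Dstat x = t]. *)
Lemma half_pdf_D_le t : 0 < t -> (q t < +oo)%E ->
  ((2^-1)%:E * q t <= G t)%E /\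
  (off_set (t^-1, 1) -> (0 < q t)%E -> ((2^-1)%:E * q t < G t)%E).
Proof.
move=> t0 qoo.
have off : off_set (t^-1, 1) <-> ~ (l t <= m0 /\ m0 <= u t).
  by rewrite /off_set /Dstat/= invrK mul1r.
rewrite off.
have q_ge0 : (0 <= q t)%E.
  by rewrite -slice_massT//; exact: slice_mass_ge0.
(* Where the density of D vanishes there is no conditional law, but the bound to prove is then 0. *)
have [q0|q0] := leP (q t) 0%E.
  split=> [|//].
  have -> : q t = 0%E by apply/eqP; rewrite eq_le q0.
  rewrite mule0; apply: adde_ge0; first exact: slice_mass_ge0.
  by apply: mule_ge0; [rewrite lee_fin invr_ge0|exact: slice_mass_ge0].
have ht : supp_D f lam t by split=> //; rewrite q0.
have [lt0 lu] := hlu lam1 ht.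
have [K KE] := cond_law_probability hf th ht.
(* The identity on the line, under [K], plays the role of Z2 given D = t. *)
pose idR : measurableTypeR R -> R := idfun.
pose X : {RV K >-> R} := HB.pack idR
  (@isMeasurableFun.Build _ _ _ _ idR (@measurable_id _ _ setT)).
have XE A : distribution K X A = cond_law_Z2 f lam t A by rewrite -KE.
have X_gt0 : distribution K X `]0, +oo[%classic = 1%E.
  rewrite XE -(cond_lawT hf th ht) /cond_law_Z2.
  by rewrite setIid setTI.
have luX m : is_median (distribution K X) m -> l t <= m /\ m <= u t.
  by move=> mX; apply: lu; move: mX; rewrite /is_median !XE.
pose S1 : set R := [set s | LW (xi_star m0 l u t * s) < LW (s / m0)].
pose S2 : set R := [set s | LW (xi_star m0 l u t * s) = LW (s / m0)].
have mS1 : measurable S1 by apply: measurable_set_ltr; [exact: LWx|exact: LWm].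
have mS2 : measurable S2 by apply: measurable_set_eqr; [exact: LWx|exact: LWm].
have G1 : slice_mass f theta better_set t = (q t * distribution K X S1)%E.
  rewrite XE; apply: slice_mass_cond_law => // s s0.
  by rewrite /better_set/= L2_d1// L2_d2.
have G2 : slice_mass f theta tie_set t = (q t * distribution K X S2)%E.
  rewrite XE; apply: slice_mass_cond_law => // s s0.
  by rewrite /tie_set/= L2_d1// L2_d2.
have q_fin : q t \is a fin_num by rewrite ge0_fin_numE.
(* The event of strictly smaller loss alone exceeds half the slice; ties can only add to it. *)
have strict : ~ (l t <= m0 /\ m0 <= u t) -> ((2^-1)%:E * q t < G t)%E.
  move=> nlu; have K1 := closer_off_median hW cW m0_gt0 X_gt0 lt0 luX nlu.
  apply: (@lt_le_trans _ _ (slice_mass f theta better_set t)).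
    by rewrite G1 muleC lte_pmul2l.
  rewrite leeDl//.
  by apply: mule_ge0; [rewrite lee_fin invr_ge0|exact: slice_mass_ge0].
split; last by move=> nlu _; exact: strict.
have [[lm mu_]|nlu] := pselect (l t <= m0 /\ m0 <= u t); last first.
  exact/ltW/strict.
(* The estimators agree on this slice, so ties fill it and their weight 1/2 already gives the
   bound. *)
rewrite G2 (_ : S2 = setT) ?probability_setT ?mule1; last first.
  apply/seteqP; split=> // s _.
  by rewrite /S2/= xi_star_between// mulrC.
by rewrite leeDr// slice_mass_ge0.
Qed.

(** Membership in [off_set] depends on x only through [Dstat x], so the slice at t misses the set
    altogether in the first case. In the second it is dominated by a whole slice of mass 0. *)
Lemma slice_mass_off_eq0 t : 0 < t -> ~ off_set (t^-1, 1) \/ q t = 0%E ->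
  slice_mass f theta off_set t = 0%E.
Proof.
move=> t0 [noff|q0]; last first.
  apply/eqP; rewrite eq_le slice_mass_ge0// andbT -q0 -slice_massT//.
  apply: ge0_le_integral => //.
  - by move=> s _; rewrite lee_fin slice_ge0.
  - apply/measurable_EFinP; apply: measurable_funTS.
    apply: measurableT_comp => //.
    by apply: measurable_slice => //; exact: measurable_off_set.
  - apply/measurable_EFinP; apply: measurable_funTS.
    apply: measurableT_comp => //.
    exact: measurable_slice.
  - move=> s _; rewrite lee_fin !patchE (mem_set I).
    by case: ifPn => // _; exact: ratio_pdf_ge0.
apply: integral0_eq => s /=; rewrite in_itv/= andbT => s0.
rewrite patchE memNset// => /= off; apply: noff; move: off.
rewrite /off_set /ratio_inv /= Dstat_ratio_inv//.
by rewrite /Dstat/= invrK mul1r.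
Qed.

End comparison.

(** * Integration over D *)

Section average_over_ratio.
Context {R : realType}.
Local Notation mu := (@lebesgue_measure R).

(** Integrating the slice bounds gives at least 1/2. If the value were at most 1/2, the bounds would
    be equalities almost everywhere, and D would almost surely avoid the region where they are
    strict, against the hypothesis. *)
Lemma GPN_xi_star_gt_half (f : R * R -> R)
  (d : measure_display) (Omega : measurableType d)
  (P : R * R -> probability Omega R) (X : Omega -> R * R)
  (W : R -> R) (m0 : R) (l u : R -> R) (theta : R * R) :
  is_pdf2 f -> measurable_fun setT X -> scale_model f P X ->
  general_loss W -> {for 1, continuous W} -> 0 < m0 ->
  measurable_fun setT l -> measurable_fun setT u ->
  (forall lam t, 1 <= lam -> supp_D f lam t ->
    0 < l t /\
    forall m, is_median (cond_law_Z2 f lam t) m -> l t <= m /\ m <= u t) ->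
  Theta0 theta ->
  (P theta [set w | (l (Dstat (X w)) <= m0)%R /\ (m0 <= u (Dstat (X w)))%R]
     < 1)%E ->
  ((2^-1)%:E <
     GPN W P X (delta_scale (xi_star m0 l u)) (delta_PNSEE m0) theta)%E.
Proof.
move=> hf mX hX hW cW m0_gt0 ml mu_ hlu th Plt1.
pose D : set R := `]0, +oo[%classic.
pose A1 := better_set W m0 l u theta; pose A2 := tie_set W m0 l u theta.
pose A3 := off_set m0 l u.
have mA1 : measurable A1 by exact: measurable_better_set.
have mA2 : measurable A2 by exact: measurable_tie_set.
have mA3 : measurable A3 by exact: measurable_off_set.
pose g A := slice_mass f theta A.
have g0 A t : (0 <= g A t)%E by exact: slice_mass_ge0.
have mg A : measurable A -> measurable_fun D (g A).
  by move=> mA; apply: measurable_funTS; exact: measurable_slice_mass.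
have Pg A : measurable A ->
    (P theta (X @^-1` A) = \int[mu]_(t in D) g A t)%E.
  by move=> mA; exact: scale_model_ratio.
have half0 : (0 <= (2^-1)%:E :> \bar R)%E by rewrite lee_fin invr_ge0.
pose G t := (g A1 t + (2^-1)%:E * g A2 t)%E.
pose H t := ((2^-1)%:E * g setT t)%E.
have mD : measurable (D : set (measurableTypeR R)) by exact: measurable_itv.
have mhg A : measurable A -> measurable_fun D (fun t => (2^-1)%:E * g A t)%E.
  by move=> mA; apply: emeasurable_funM => //; exact: mg.
have hg0 A t : (0 <= (2^-1)%:E * g A t)%E by exact: mule_ge0.
have GPNE : GPN W P X (delta_scale (xi_star m0 l u)) (delta_PNSEE m0) theta =
    (\int[mu]_(t in D) G t)%E.
  rewrite ge0_integralD//; [|exact: mg|exact: mhg].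
  rewrite ge0_integralZl_EFin ?invr_ge0//; last exact: mg.
  by rewrite -!Pg.
have gT : (\int[mu]_(t in D) g setT t = 1)%E.
  by rewrite -Pg// preimage_setT probability_setT.
have HE : (\int[mu]_(t in D) H t = (2^-1)%:E)%E.
  by rewrite ge0_integralZl_EFin ?invr_ge0 ?gT ?mule1//; exact: mg.
(* The density of D has integral 1, hence is finite almost everywhere; the slice bounds need
   this. *)
have gT_fin : {ae mu, forall t, D t -> g setT t \is a fin_num}.
  apply: integrable_ae => //; apply/integrableP; split; first exact: mg.
  under eq_integral do rewrite gee0_abs//.
  by rewrite gT ltry.
have aeF : Filter (nbhs (almost_everywhere mu)).
  exact: (ae_filter_ringOfSetsType mu).
have HG : {ae mu, forall t, D t -> (H t <= G t)%E}.
  apply: filterS gT_fin => t gt Dt.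
  have t0 : 0 < t by move: Dt; rewrite /D/= in_itv/= andbT.
  move: (gt Dt); rewrite /H /g slice_massT// => qfin.
  have qoo : (pdf_D f (theta.2 / theta.1) t < +oo)%E.
    by rewrite -ge0_fin_numE// -slice_massT//; exact: g0.
  by have [] := half_pdf_D_le hf hW cW m0_gt0 hlu th t0 qoo.
rewrite ltNge; apply/negP => GPNle.
have GH : {ae mu, forall t, D t -> (G t <= H t)%E}.
  apply: ae_le_of_integral_le => //.
  - exact: mhg.
  - by apply: emeasurable_funD; [exact: mg|exact: mhg].
  - by move=> t _; exact: hg0.
  - by move=> t _; apply: adde_ge0; [exact: g0|exact: hg0].
  - by rewrite HE ltry.
  - by rewrite HE -GPNE.
(* On an off slice with positive density the strict bound contradicts [GH], so almost every slice of
   [off_set] has mass 0. *)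
have g3 : {ae mu, forall t, D t -> g A3 t = 0%E}.
  apply: filterS2 gT_fin GH => t gt Gt Dt.
  have t0 : 0 < t by move: Dt; rewrite /D/= in_itv/= andbT.
  have q0 : (0 <= pdf_D f (theta.2 / theta.1) t)%E.
    by rewrite -slice_massT//; exact: g0.
  move: (gt Dt); rewrite /g slice_massT// => qfin.
  apply: slice_mass_off_eq0 => //.
  have [q_le0|q_gt0] := leP (pdf_D f (theta.2 / theta.1) t) 0%E.
    by right; apply/eqP; rewrite eq_le q_le0.
  have qoo : (pdf_D f (theta.2 / theta.1) t < +oo)%E by rewrite -ge0_fin_numE.
  left => off.
  have [_ /(_ off q_gt0)] := half_pdf_D_le hf hW cW m0_gt0 hlu th t0 qoo.
  by have := Gt Dt; rewrite /H /G /g slice_massT// leNgt => /negP.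
have : P theta (X @^-1` A3) = 0%E.
  rewrite Pg//; rewrite (@ge0_ae_eq_integral _ _ _ mu _ _ (cst 0%E))//.
  - by rewrite integral0.
  - exact: mg.
move=> PA3.
move: Plt1.
rewrite (_ : [set w | _] = ~` (X @^-1` A3)); last first.
  by apply/seteqP; split=> w /=; rewrite /A3 /off_set /= notK.
rewrite probability_setC; last by rewrite -[X in measurable X]setTI; exact: mX.
by rewrite [X in (1 - X)%E]PA3 sube0 ltxx.
Qed.

End average_over_ratio.

Unset Implicit Arguments.

Theorem corollary4p2p2 (R : realType) (f : R * R -> R)
  (d : measure_display) (Omega : measurableType d)
  (P : R * R -> probability Omega R) (X : Omega -> R * R)
  (W : R -> R) (m0 : R) (l u : R -> R)
  (hf : is_pdf2 f)
  (mX : measurable_fun setT X)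
  (hX : scale_model f P X)
  (hW : general_loss W)
  (cW : {for 1, continuous W})
  (m0_gt0 : 0 < m0)
  (m0_median : forall theta, Theta0 theta ->
     is_median (fun A => P theta [set w | A ((X w).2 / theta.2)]) m0)
  (mesl : measurable_fun setT l)
  (mesu : measurable_fun setT u)
  (hlu : forall lam t, 1 <= lam -> supp_D f lam t ->
     0 < l t /\
     forall m, is_median (cond_law_Z2 f lam t) m -> l t <= m /\ m <= u t)
  (hlt1 : forall theta, Theta0 theta ->
     (P theta [set w | (l (Dstat (X w)) <= m0)%R /\ (m0 <= u (Dstat (X w)))%R]
        < 1)%E) :
  nearer W P X (delta_scale (xi_star m0 l u)) (delta_PNSEE m0).
Proof.
have gt_half theta : Theta0 theta -> ((2^-1)%:E <
    GPN W P X (delta_scale (xi_star m0 l u)) (delta_PNSEE m0) theta)%E.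
  move=> th.
  apply: (GPN_xi_star_gt_half hf mX hX hW cW m0_gt0 mesl mesu hlu th).
  exact: hlt1.
split=> [theta /gt_half/ltW//|].
(* Strictness holds at every parameter; (1, 1) is merely a convenient one. *)
by exists (1, 1); [split=> /=|apply: gt_half; split=> /=].
Qed.
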